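(* Let $\mathbf{G}$ be a $\Sigma$-structure, $\mathscr{M}$ a minion, $\mathcal{D}$ a finite description over $\mathscr{M}$, $\mathcal{I}$ a $\Sigma$-interpretation over $\mathscr{M}$, and $h\ge r$ natural numbers. Suppose that (1) the set of finite $\Sigma$-structures $\mathbf{T}$ with $\mathbf{G}\to\mathbf{T}$ is undecidable, (2) $\mathcal{I}$ is internal at arity $h$ w.r.t. $\mathcal{D}$, (3) $\mathbf{S}_\mathcal{I}$ is finitely equivalent to $\mathbf{G}$, and (4) $r\ge\mathrm{ar}(Q)$ for every $Q\in\mathcal{D}$ and for $Q=U^\mathcal{I}$. Then the set of finite templates of the form $(\mathbf{K}^h_r,\mathbf{B})$ for which $\mathscr{M}\to\mathrm{Pol}(\mathbf{K}^h_r,\mathbf{B})$ holds is undecidable.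
   Context: Minions: disjoint sets $\mathscr{M}(n)$ with maps $f\mapsto f^\pi\in\mathscr{M}(m)$ for $\pi:[n]\to[m]$, $f^{\mathrm{id}}=f$, $f^{\pi_1\circ\pi_2}=(f^{\pi_2})^{\pi_1}$; homomorphisms preserve arity and minoring; a partial homomorphism up to arity $h$, written $\mathscr{M}\rightharpoonup_h\mathscr{N}$, is an arity-preserving map defined exactly on the elements of arity at most $h$ that commutes with minoring. $\mathrm{Pol}(\mathbf{A},\mathbf{B})$: $n$-ary elements are homomorphisms $\mathbf{A}^n\to\mathbf{B}$, $f^\pi(\mathbf{b})=f(\mathbf{b}\circ\pi)$. Descriptions: a property is a subset $P\subseteq\mathscr{M}(n)$ (arity $n$); a description $\mathcal{D}$ is a set of properties; $f\sim_\mathcal{D}g$ ($f,g\in\mathscr{M}(n)$) iff for all $P\in\mathcal{D}$ and $\pi:[n]\to[\mathrm{ar}(P)]$, $f^\pi\in P\iff g^\pi\in P$; $\mathscr{M}/\mathcal{D}$ is the quotient minion, $[f]^\pi=[f^\pi]$. $Q$ is $\mathcal{D}$-stable if it is a union of $\sim_\mathcal{D}$-classes; $Q$ is internal at arity $h\ge\mathrm{ar}(Q)$ w.r.t. $\mathcal{D}$ if it is $\mathcal{D}$-stable and every partial homomorphism $F:\mathscr{M}\rightharpoonup_h\mathscr{M}/\mathcal{D}$ satisfies $F(Q)\subseteq Q/\mathcal{D}$. Interpretations: a $\Sigma$-interpretation $\mathcal{I}$ over $\mathscr{M}$ consists of properties $U^\mathcal{I}$, $R^\mathcal{I}$ ($R\in\Sigma$)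 and maps $\Pi^\mathcal{I}_{R,i}:[\mathrm{ar}(R^\mathcal{I})]\to[\mathrm{ar}(U^\mathcal{I})]$, $i\in[\mathrm{ar}(R)]$; it is internal at arity $h$ w.r.t. $\mathcal{D}$ if all of $U^\mathcal{I}$ and $R^\mathcal{I}$ are. Its global structure $\mathbf{S}_\mathcal{I}$ has universe $U^\mathcal{I}$ and $(f_1,\dots,f_{\mathrm{ar}(R)})\in R^{S_\mathcal{I}}$ iff there is $g\in R^\mathcal{I}$ with $g^{\Pi^\mathcal{I}_{R,i}}=f_i$ for all $i$. Two similar structures are finitely equivalent if every finite structure maps into one iff it maps into the other. $\mathbf{K}^h_r$ ($h\ge r$): one relation symbol of arity $m=r^h$, universe $[r]$, relation $\{(\pi_1(i),\dots,\pi_m(i)):i\in[h]\}$ where $\pi_1,\dots,\pi_m$ is the lexicographic enumeration of $[r]^{[h]}$. A finite template is a pair $(\mathbf{A},\mathbf{B})$ of finite similar structures with $\mathbf{A}\to\mathbf{B}$. *)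

(* Defs.v *)
From mathcomp Require Import all_boot.
From mathcomp Require Import boolp classical_sets functions cardinality.

Set Implicit Arguments.
Unset Strict Implicit.
Unset Printing Implicit Defensive.

Local Open Scope classical_set_scope.

Record signature := Signature {
  sym : finType;
  sar : sym -> nat
}.

Record structure (Sig : signature) := Structure {
  dom :> Type;
  rel_of : forall R : sym Sig, set ((sar R).-tuple dom)
}.

Arguments rel_of {Sig} s R _.

Definition is_hom (Sig : signature) (X Y : structure Sig) (f : X -> Y) : Prop :=
  forall (R : sym Sig) (t : (sar R).-tuple X),
    rel_of X R t -> rel_of Y R (map_tuple f t).

Definition maps_to (Sig : signature) (X Y : structure Sig) : Prop :=
  exists f : X -> Y, is_hom f.

Definition finitely_equivalent (Sig : signature) (S G : structure Sig) : Prop :=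
  forall X : structure Sig, finite_set [set: X] -> (maps_to X S <-> maps_to X G).

(* Finite structures as instances of decision problems: up to isomorphism, the
   universe is {0, ..., n - 1}. *)
Record fstructure (Sig : signature) := FStructure {
  fs_size : nat;
  fs_rel : forall R : sym Sig, {set (sar R).-tuple 'I_fs_size}
}.

Arguments fs_rel {Sig} f R.

Definition structure_of (Sig : signature) (X : fstructure Sig) : structure Sig :=
  @Structure Sig 'I_(fs_size X) (fun R t => t \in fs_rel X R).

Coercion structure_of : fstructure >-> structure.

Record template (Sig : signature) := Template {
  tsrc : fstructure Sig;
  ttgt : fstructure Sig;
  templateP : maps_to tsrc ttgt
}.

(* The total recursive functions on the natural numbers. Minimization is only
   applied to regular functions, so every function in the class is total; by
   Kleene's normal form theorem these are exactly the total mu-recursive, i.e.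
   the total Turing-computable, functions. *)
Inductive recursive : forall k : nat, (k.-tuple nat -> nat) -> Prop :=
| rec_zero (k : nat) :
    recursive (fun _ : k.-tuple nat => 0)
| rec_succ :
    recursive (fun x : 1.-tuple nat => (thead x).+1)
| rec_proj (k : nat) (i : 'I_k) :
    recursive (fun x : k.-tuple nat => tnth x i)
| rec_comp (k l : nat) (f : l.-tuple nat -> nat) (g : 'I_l -> k.-tuple nat -> nat) :
    recursive f -> (forall i, recursive (g i)) ->
    recursive (fun x : k.-tuple nat => f [tuple g i x | i < l])
| rec_prim (k : nat) (f : k.-tuple nat -> nat) (g : k.+2.-tuple nat -> nat) :
    recursive f -> recursive g ->
    recursive (fun x : k.+1.-tuple nat =>
      iteri (thead x) (fun n v => g [tuple of n :: v :: behead_tuple x])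
            (f (behead_tuple x)))
| rec_min (k : nat) (f : k.+1.-tuple nat -> nat) (g : k.-tuple nat -> nat) :
    recursive f ->
    (forall x, f [tuple of g x :: x] = 0 /\
               forall y, y < g x -> f [tuple of y :: x] <> 0) ->
    recursive g.

Definition decidable_set (X : Type) (k : nat) (code : X -> k.-tuple nat)
    (P : set X) : Prop :=
  exists2 chi : k.-tuple nat -> nat, recursive chi &
    forall x : X, chi (code x) = nat_of_bool `[< P x >].

Definition undecidable_set (X : Type) (k : nat) (code : X -> k.-tuple nat)
    (P : set X) : Prop := ~ decidable_set code P.

(* A tuple over {0, ..., n - 1}, read as a number in base n. *)
Definition tuple_code (n a : nat) (t : a.-tuple 'I_n) : nat :=
  \sum_(j < a) tnth t j * n ^ j.

(* The binary digits of the code of a relation form its characteristic string. *)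
Definition fs_rel_code (Sig : signature) (X : fstructure Sig) (R : sym Sig) : nat :=
  \sum_(t in fs_rel X R) 2 ^ tuple_code t.

Definition fcode (Sig : signature) (X : fstructure Sig) : #|sym Sig|.+1.-tuple nat :=
  [tuple of fs_size X :: [tuple fs_rel_code X (enum_val i) | i < #|sym Sig| ]].

Definition tcode (Sig : signature) (AB : template Sig) :
    (#|sym Sig|.+1 + #|sym Sig|.+1).-tuple nat :=
  [tuple of fcode (tsrc AB) ++ fcode (ttgt AB)].

(* Arities are positive: [elt M n] is the set of elements of arity n.+1. *)
Record minion := Minion {
  elt :> nat -> Type;
  minor : forall n m : nat, ('I_n.+1 -> 'I_m.+1) -> elt n -> elt m;
  minor_id : forall (n : nat) (f : elt n), minor id f = f;
  minor_comp : forall (n m p : nat) (pi1 : 'I_m.+1 -> 'I_p.+1)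
      (pi2 : 'I_n.+1 -> 'I_m.+1) (f : elt n),
    minor (pi1 \o pi2) f = minor pi1 (minor pi2 f)
}.

Definition minion_maps_to (M N : minion) : Prop :=
  exists F : forall n : nat, M n -> N n,
    forall (n m : nat) (pi : 'I_n.+1 -> 'I_m.+1) (f : M n),
      F m (minor pi f) = minor pi (F n f).

Record partial_hom (h : nat) (M N : minion) := PartialHom {
  phom : forall n : nat, n.+1 <= h -> M n -> N n;
  phom_minor : forall (n m : nat) (len : n.+1 <= h) (lem : m.+1 <= h)
      (pi : 'I_n.+1 -> 'I_m.+1) (f : M n),
    phom lem (minor pi f) = minor pi (phom len f)
}.

Definition power (Sig : signature) (A : structure Sig) (n : nat) : structure Sig :=
  @Structure Sig ('I_n -> A)
    (fun R t => forall i : 'I_n, rel_of A R (map_tuple (fun a : 'I_n -> A => a i) t)).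

Section Pol.
Variables (Sig : signature) (A B : structure Sig).

Definition pol_elt (n : nat) : Type := {f : power A n.+1 -> B | is_hom f}.

Lemma pol_minor_hom (n m : nat) (pi : 'I_n.+1 -> 'I_m.+1) (f : pol_elt n) :
  is_hom (fun b : power A m.+1 => sval f (b \o pi)).
Proof.
move=> R t Ht.
have -> : map_tuple (fun b : power A m.+1 => sval f (b \o pi)) t =
          map_tuple (sval f) (map_tuple (fun b : power A m.+1 => b \o pi) t).
  by apply: val_inj => /=; rewrite -map_comp.
apply: (svalP f) => i /=.
rewrite (_ : map_tuple _ _ = map_tuple (fun a : power A m.+1 => a (pi i)) t) //.
by apply: val_inj => /=; rewrite -map_comp.
Qed.

Definition pol_minor (n m : nat) (pi : 'I_n.+1 -> 'I_m.+1) (f : pol_elt n) :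
  pol_elt m := exist _ _ (pol_minor_hom pi f).

Lemma pol_minor_id (n : nat) (f : pol_elt n) : pol_minor id f = f.
Proof. by case: f => f hf; apply: eq_exist. Qed.

Lemma pol_minor_comp (n m p : nat) (pi1 : 'I_m.+1 -> 'I_p.+1)
    (pi2 : 'I_n.+1 -> 'I_m.+1) (f : pol_elt n) :
  pol_minor (pi1 \o pi2) f = pol_minor pi1 (pol_minor pi2 f).
Proof. exact: eq_exist. Qed.

Definition Pol : minion := Minion pol_minor_id pol_minor_comp.

End Pol.

(* [par P] is one less than the arity of the property [P], see [elt]. *)
Record property (M : minion) := Property {
  par : nat;
  pset : set (M par)
}.

Arguments pset {M} p _.

Definition ar (M : minion) (P : property M) : nat := (par P).+1.

Section Description.
Variables (M : minion) (D : set (property M)).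

Definition deq (n : nat) (f g : M n) : Prop :=
  forall P : property M, D P -> forall pi : 'I_n.+1 -> 'I_(ar P),
    pset P (minor pi f) <-> pset P (minor pi g).

Lemma deq_refl (n : nat) (f : M n) : deq f f.
Proof. by []. Qed.

Lemma deq_sym (n : nat) (f g : M n) : deq f g -> deq g f.
Proof. by move=> fg P DP pi; apply: iff_sym; apply: fg. Qed.

Lemma deq_trans (n : nat) (f g k : M n) : deq f g -> deq g k -> deq f k.
Proof. by move=> fg gk P DP pi; apply: iff_trans (fg P DP pi) (gk P DP pi). Qed.

Lemma deq_minor (n m : nat) (pi : 'I_n.+1 -> 'I_m.+1) (f g : M n) :
  deq f g -> deq (minor pi f) (minor pi g).
Proof. by move=> fg P DP rho; rewrite -!minor_comp; apply: fg. Qed.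

Definition quo_elt (n : nat) : Type :=
  {C : set (M n) | exists f : M n, C = [set g | deq f g]}.

Definition quo_class (n : nat) (f : M n) : quo_elt n :=
  exist _ [set g | deq f g] (ex_intro _ f erefl).

(* The class [f]^pi = [f^pi], written without choosing a representative. *)
Definition quo_minor_set (n m : nat) (pi : 'I_n.+1 -> 'I_m.+1) (C : set (M n)) :
  set (M m) := [set g | exists2 f, C f & deq (minor pi f) g].

Lemma quo_minor_setE (n m : nat) (pi : 'I_n.+1 -> 'I_m.+1) (f : M n) :
  quo_minor_set pi [set g | deq f g] = [set g | deq (minor pi f) g].
Proof.
apply/seteqP; split=> g /=.
  by case=> f' ff' /(deq_trans (deq_minor pi ff')).
by exists f => //; apply: deq_refl.
Qed.

Lemma quo_minorP (n m : nat) (pi : 'I_n.+1 -> 'I_m.+1) (c : quo_elt n) :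
  exists f : M m, quo_minor_set pi (sval c) = [set g | deq f g].
Proof.
by have [f ->] := svalP c; exists (minor pi f); apply: quo_minor_setE.
Qed.

Definition quo_minor (n m : nat) (pi : 'I_n.+1 -> 'I_m.+1) (c : quo_elt n) :
  quo_elt m := exist _ _ (quo_minorP pi c).

Lemma quo_minor_class (n m : nat) (pi : 'I_n.+1 -> 'I_m.+1) (f : M n) :
  quo_minor pi (quo_class f) = quo_class (minor pi f).
Proof. by apply: eq_exist; apply: quo_minor_setE. Qed.

Lemma quo_classP (n : nat) (c : quo_elt n) : exists f : M n, c = quo_class f.
Proof. by case: c => C [f Cf]; exists f; apply: eq_exist. Qed.

Lemma quo_minor_id (n : nat) (c : quo_elt n) : quo_minor id c = c.
Proof. by have [f ->] := quo_classP c; rewrite quo_minor_class minor_id. Qed.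

Lemma quo_minor_comp (n m p : nat) (pi1 : 'I_m.+1 -> 'I_p.+1)
    (pi2 : 'I_n.+1 -> 'I_m.+1) (c : quo_elt n) :
  quo_minor (pi1 \o pi2) c = quo_minor pi1 (quo_minor pi2 c).
Proof.
by have [f ->] := quo_classP c; rewrite !quo_minor_class minor_comp.
Qed.

Definition quotient_minion : minion := Minion quo_minor_id quo_minor_comp.

Definition stable (Q : property M) : Prop :=
  exists S : set (quo_elt (par Q)), pset Q = \bigcup_(c in S) sval c.

Definition quo_property (Q : property M) : set (quotient_minion (par Q)) :=
  [set quo_class f | f in pset Q].

Definition internal (h : nat) (Q : property M) : Prop :=
  stable Q /\
  exists leh : ar Q <= h, forall F : partial_hom h M quotient_minion,
    phom F leh @` pset Q `<=` @quo_property Q.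

End Description.

Record interpretation (Sig : signature) (M : minion) := Interpretation {
  int_univ : property M;
  int_rel : sym Sig -> property M;
  int_map : forall R : sym Sig, 'I_(sar R) -> 'I_(ar (int_rel R)) -> 'I_(ar int_univ)
}.

Definition internal_interpretation (Sig : signature) (M : minion)
    (D : set (property M)) (h : nat) (I : interpretation Sig M) : Prop :=
  internal D h (int_univ I) /\ forall R : sym Sig, internal D h (int_rel I R).

Definition global_structure (Sig : signature) (M : minion)
    (I : interpretation Sig M) : structure Sig :=
  @Structure Sig {f : M (par (int_univ I)) | pset (int_univ I) f}
    (fun R t => exists2 g : M (par (int_rel I R)), pset (int_rel I R) g &
       forall i : 'I_(sar R), minor (int_map (R := R) i) g = sval (tnth t i)).

Definition Ksig (h r : nat) : signature := @Signature unit (fun=> r ^ h).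

Lemma lex_map_subproof (h r : nat) (j : 'I_(r ^ h)) (i : 'I_h) :
  j %/ r ^ (h - i.+1) %% r < r.
Proof.
rewrite ltn_pmod //; case: r j => // -[j].
by rewrite exp0n // (leq_ltn_trans _ (ltn_ord i)).
Qed.

(* The j-th map [h] -> [r] in lexicographic order lists the h base-r digits of
   j, the most significant digit being the value at 0. *)
Definition lex_map (h r : nat) (j : 'I_(r ^ h)) (i : 'I_h) : 'I_r :=
  Ordinal (lex_map_subproof j i).

Definition K (h r : nat) : fstructure (Ksig h r) :=
  @FStructure (Ksig h r) r
    (fun=> [set [tuple lex_map j i | j < r ^ h] | i : 'I_h]%SET).

(* Main.v *)
(** Write N for the quotient minion M/D, which is finite in every arity.  A finite
    structure T is sent to the target B whose elements are pairs (c, v) with c in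
    N(r) and v an element of T or a dummy.  A tuple of pairs (c_j, v_j), indexed by
    the maps pi_j : [h] -> [r], is related when some c in N(h) has the c_j as its
    minors c^(pi_j) and the v_j respect every constraint that the interpretation
    places on the minors of c.  Homomorphisms M -> Pol(K, B) are the same as
    homomorphisms to B from the free structure on M(r).  A homomorphism S_I -> T
    yields one of these directly.  Conversely, the first components of one of these
    form a partial homomorphism M -> M/D up to arity h, because elements of N are
    determined by their minors of arity r; by internality it preserves U and all R,
    so the second components give S_I -> T.  By compactness S_I -> T iff G -> T.
    Since B need not admit a homomorphism from K, a decision procedure for
    templates is only consulted after a bounded search for one; if there is none,
    then G does not map to T. *)

Require Import Defs.
From mathcomp Require Import all_boot.
From mathcomp Require Import boolp classical_sets functions cardinality filter.

Set Implicit Arguments.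
Unset Strict Implicit.
Unset Printing Implicit Defensive.

Local Open Scope classical_set_scope.

(** * Recursive functions and predicates *)

Lemma recursive_ext (k : nat) (f g : k.-tuple nat -> nat) :
  recursive f -> f =1 g -> recursive g.
Proof. by move=> rf /funext <-. Qed.

Lemma recursive_comp1 (k : nat) (F : nat -> nat) (g : k.-tuple nat -> nat) :
  recursive (fun x : 1.-tuple nat => F (thead x)) -> recursive g ->
  recursive (fun x => F (g x)).
Proof.
move=> rF rg; apply: recursive_ext (rec_comp rF (fun _ : 'I_1 => rg)) _ => x /=.
by rewrite /thead tnth_mktuple.
Qed.

Lemma recursive_succ (k : nat) (f : k.-tuple nat -> nat) :
  recursive f -> recursive (fun x => (f x).+1).
Proof. exact: recursive_comp1 rec_succ. Qed.

Lemma recursive_const (k c : nat) : recursive (fun _ : k.-tuple nat => c).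
Proof. by elim: c => [|c /recursive_succ//]; apply: rec_zero. Qed.

Lemma recursive_thead (k : nat) :
  recursive (fun x : k.+1.-tuple nat => thead x).
Proof. exact: rec_proj. Qed.

Lemma tnth_behead_tuple (k : nat) (T : Type) (x : k.+1.-tuple T) (i : 'I_k) :
  tnth (behead_tuple x) i = tnth x (lift ord0 i).
Proof. by case/tupleP: x => a x; rewrite tnthS; congr tnth; apply: val_inj. Qed.

Lemma recursive_behead (k : nat) (f : k.-tuple nat -> nat) :
  recursive f -> recursive (fun y : k.+1.-tuple nat => f (behead_tuple y)).
Proof.
move=> rf; apply: recursive_ext (rec_comp rf
  (fun i : 'I_k => rec_proj (lift ord0 i))) _ => y.
by congr f; apply: eq_from_tnth => i; rewrite tnth_mktuple tnth_behead_tuple.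
Qed.

Lemma recursive_cons (k : nat) (f : k.+1.-tuple nat -> nat)
    (g : k.-tuple nat -> nat) :
  recursive f -> recursive g -> recursive (fun x => f [tuple of g x :: x]).
Proof.
move=> rf rg.
pose G (i : 'I_k.+1) : k.-tuple nat -> nat :=
  if unlift ord0 i is Some j then fun x => tnth x j else g.
have rG i : recursive (G i).
  by rewrite /G; case: unliftP => [j _|_] //; apply: rec_proj.
apply: recursive_ext (rec_comp rf rG) _ => x.
congr f; apply: eq_from_tnth => i; rewrite tnth_mktuple /G.
by case: unliftP => [j ->|->]; rewrite ?tnthS ?tnth0.
Qed.

(** [rec_prim] ties the number of iterations to the first argument; substituting [b x] there with
    [recursive_cons] frees it. *)
Lemma recursive_iteri (k : nat) (F : nat -> nat -> k.-tuple nat -> nat)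
    (b a : k.-tuple nat -> nat) :
  recursive (fun y : k.+2.-tuple nat =>
    F (thead y) (thead (behead_tuple y)) (behead_tuple (behead_tuple y))) ->
  recursive b -> recursive a ->
  recursive (fun x => iteri (b x) (fun i v => F i v x) (a x)).
Proof.
move=> rF rb ra.
apply: recursive_ext (recursive_cons (rec_prim ra rF) rb) _ => x /=.
congr iteri; last by congr a; apply: val_inj.
by apply/funext => i; apply/funext => v; congr F; apply: val_inj.
Qed.

Lemma recursive_add (k : nat) (f g : k.-tuple nat -> nat) :
  recursive f -> recursive g -> recursive (fun x => f x + g x).
Proof.
move=> rf rg.
apply: recursive_ext (@recursive_iteri k (fun _ v _ => v.+1) f g _ rf rg) _.
  exact/recursive_succ/recursive_behead/recursive_thead.
by move=> x; elim: (f x) => //= n ->; rewrite addSn.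
Qed.

Lemma recursive_pred (k : nat) (f : k.-tuple nat -> nat) :
  recursive f -> recursive (fun x => (f x).-1).
Proof.
move=> rf; apply: recursive_ext
  (@recursive_iteri k (fun i _ _ => i) f (fun=> 0) _ rf (rec_zero _)) _.
  exact: recursive_thead.
by move=> x; case: (f x).
Qed.

Lemma recursive_sub (k : nat) (f g : k.-tuple nat -> nat) :
  recursive f -> recursive g -> recursive (fun x => f x - g x).
Proof.
move=> rf rg; apply: recursive_ext
  (@recursive_iteri k (fun _ v _ => v.-1) g f _ rg rf) _.
  exact/recursive_pred/recursive_behead/recursive_thead.
by move=> x; elim: (g x) => [|n /= ->]; rewrite ?subn0 ?subnS.
Qed.

Lemma recursive_sum (k : nat) (F : nat -> k.-tuple nat -> nat)
    (b : k.-tuple nat -> nat) :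
  recursive (fun y : k.+1.-tuple nat => F (thead y) (behead_tuple y)) ->
  recursive b -> recursive (fun x => \sum_(i < b x) F i x).
Proof.
move=> rF rb; apply: recursive_ext
  (@recursive_iteri k (fun i v x => v + F i x) b (fun=> 0) _ rb (rec_zero _)) _.
  apply: recursive_add; first exact/recursive_behead/recursive_thead.
  (* The arguments are counter, accumulator, parameters. [F] must not see the accumulator, so the
     projections skip position 1. *)
  apply: recursive_ext (rec_comp rF (_ : forall i : 'I_k.+1, recursive
    (fun y : k.+2.-tuple nat => if unlift ord0 i is Some j
      then tnth y (lift ord0 (lift ord0 j)) else thead y))) _.
    by move=> i; case: unliftP => [j _|_]; apply: rec_proj.
  move=> y /=; congr F; first by rewrite /thead tnth_mktuple unlift_none.
  apply: eq_from_tnth => i.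
  by rewrite !tnth_behead_tuple tnth_mktuple liftK.
move=> x; elim: (b x) => [|n /= ->]; first by rewrite big_ord0.
by rewrite big_ord_recr.
Qed.

Lemma recursive_mul (k : nat) (f g : k.-tuple nat -> nat) :
  recursive f -> recursive g -> recursive (fun x => f x * g x).
Proof.
move=> rf rg; apply: recursive_ext
  (@recursive_sum k (fun=> g) f (recursive_behead rg) rf) _ => x.
by rewrite sum_nat_const card_ord.
Qed.

Lemma recursive_exp (k : nat) (f g : k.-tuple nat -> nat) :
  recursive f -> recursive g -> recursive (fun x => f x ^ g x).
Proof.
move=> rf rg; apply: recursive_ext (@recursive_iteri k (fun _ v x => f x * v)
  g (fun=> 1) _ rg (recursive_const _ _)) _.
  apply: recursive_mul; last exact/recursive_behead/recursive_thead.
  exact: (recursive_behead (recursive_behead rf)).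
by move=> x; elim: (g x) => //= n ->; rewrite expnS.
Qed.

Lemma recursive_sum_fin (k a : nat) (F : 'I_a -> k.-tuple nat -> nat) :
  (forall i, recursive (F i)) -> recursive (fun x => \sum_i F i x).
Proof.
elim: a F => [|a IH] F rF.
  by apply: recursive_ext (rec_zero _) _ => x; rewrite big_ord0.
apply: recursive_ext (recursive_add (rF ord0)
  (IH (fun i => F (lift ord0 i)) (fun i => rF _))) _ => x.
by rewrite big_ord_recl.
Qed.

(** * Closure properties of recursive predicates *)

Definition recursive_predicate (k : nat) (P : k.-tuple nat -> Prop) : Prop :=
  recursive (fun x => nat_of_bool `[< P x >]).

Lemma asbool_nat_eq (P Q : Prop) :
  (P <-> Q) -> nat_of_bool `[< P >] = nat_of_bool `[< Q >].
Proof. by move=> /asbool_equiv_eq ->. Qed.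

Lemma recp_ext (k : nat) (P Q : k.-tuple nat -> Prop) :
  recursive_predicate P -> (forall x, P x <-> Q x) -> recursive_predicate Q.
Proof. by move=> rP PQ; apply: recursive_ext rP _ => x; apply: asbool_nat_eq. Qed.

(** The truth value of a proposition free of the input is one of two constants, whichever it is.
    Facts about the fixed minion enter the algorithm this way. *)
Lemma recp_const (k : nat) (P : Prop) :
  recursive_predicate (fun _ : k.-tuple nat => P).
Proof. exact: recursive_const. Qed.

Lemma recp_not (k : nat) (P : k.-tuple nat -> Prop) :
  recursive_predicate P -> recursive_predicate (fun x => ~ P x).
Proof.
move=> rP; apply: recursive_ext (recursive_sub (recursive_const k 1) rP) _ => x.
by rewrite asbool_neg; case: asbool.
Qed.

Lemma recp_and (k : nat) (P Q : k.-tuple nat -> Prop) :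
  recursive_predicate P -> recursive_predicate Q ->
  recursive_predicate (fun x => P x /\ Q x).
Proof.
move=> rP rQ; apply: recursive_ext (recursive_mul rP rQ) _ => x.
by rewrite asbool_and; do 2!case: asbool.
Qed.

Lemma recp_imp (k : nat) (P Q : k.-tuple nat -> Prop) :
  recursive_predicate P -> recursive_predicate Q ->
  recursive_predicate (fun x => P x -> Q x).
Proof.
move=> rP rQ; apply: recp_ext (recp_not (recp_and rP (recp_not rQ))) _ => x.
split=> [nPQ Px|PQ [/PQ]//]; apply: contrapT => nQ; exact: nPQ.
Qed.

(** Over a fixed finite type the quantifier unfolds into a finite conjunction, so nothing has to be
    computable in [a]. *)
Lemma recp_forall (k : nat) (A : Type) (P : A -> k.-tuple nat -> Prop) :
  finite_set [set: A] -> (forall a, recursive_predicate (P a)) ->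
  recursive_predicate (fun x => forall a, P a x).
Proof.
elim/Pchoice: A => A in P *.
move=> /finite_seqP[s sE] rP.
suff rs : recursive_predicate (fun x => forall a, a \in s -> P a x).
  apply: recp_ext rs _ => x; split=> [Px a|Px a _//]; apply: Px.
  by have : [set: A] a by []; rewrite sE.
elim: s {sE} => [|a s IH]; first by apply: recp_ext (recp_const _ True) _.
apply: recp_ext (recp_and (rP a) IH) _ => x; split.
  by move=> [Pa Ps] b; rewrite inE => /predU1P[->|/Ps].
by move=> Ps; split=> [|b bs]; apply: Ps; rewrite inE ?eqxx// bs orbT.
Qed.

Lemma recp_exists (k : nat) (A : Type) (P : A -> k.-tuple nat -> Prop) :
  finite_set [set: A] -> (forall a, recursive_predicate (P a)) ->
  recursive_predicate (fun x => exists a, P a x).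
Proof.
move=> finA rP.
apply: recp_ext (recp_not (recp_forall finA (fun a => recp_not (rP a)))) _ => x.
by split=> [/existsNP[a /contrapT]|[a Pa] /(_ a)//]; exists a.
Qed.

Lemma recp_leq (k : nat) (f g : k.-tuple nat -> nat) :
  recursive f -> recursive g -> recursive_predicate (fun x => f x <= g x).
Proof.
move=> rf rg; apply: recursive_ext
  (recursive_sub (recursive_const k 1) (recursive_sub rf rg)) _ => x.
by rewrite asboolb -subn_eq0; case: (f x - g x).
Qed.

Lemma recp_eq (k : nat) (f g : k.-tuple nat -> nat) :
  recursive f -> recursive g -> recursive_predicate (fun x => f x = g x).
Proof.
move=> rf rg; apply: recp_ext (recp_and (recp_leq rf rg) (recp_leq rg rf)) _ => x.
by split=> [[fg gf]|->//]; apply/eqP; rewrite eqn_leq fg.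
Qed.

Lemma recp_exists_lt (k : nat) (P : nat -> k.-tuple nat -> Prop)
    (b : k.-tuple nat -> nat) :
  recursive_predicate (fun y : k.+1.-tuple nat => P (thead y) (behead_tuple y)) ->
  recursive b -> recursive_predicate (fun x => exists2 i, i < b x & P i x).
Proof.
move=> rP rb; apply: recp_ext (recp_leq (recursive_const k 1)
  (recursive_sum (F := fun i x => nat_of_bool `[< P i x >]) rP rb)) _ => x.
rewrite lt0n sum_nat_eq0 negb_forall; split.
  by move=> /existsP[i]; rewrite eqb0 negbK => /asboolP Pi; exists i.
move=> [i ib Pi]; apply/existsP; exists (Ordinal ib).
by rewrite eqb0 negbK; apply/asboolP.
Qed.

Lemma recursive_div (k : nat) (f g : k.-tuple nat -> nat) :
  recursive f -> recursive g -> recursive (fun x => f x %/ g x).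
Proof.
move=> rf rg.
(* The quotient counts the positive multiples of [g x] up to [f x]. The factor [1 <= g x] added
   below yields the conventional value 0 for division by 0. *)
have r1 : recursive (fun x : k.-tuple nat =>
    \sum_(i < f x) nat_of_bool `[< i.+1 * g x <= f x >]).
  apply: (@recursive_sum k (fun i x => nat_of_bool `[< i.+1 * g x <= f x >])) => //.
  apply: recp_leq; last exact: recursive_behead.
  apply: recursive_mul; last exact: recursive_behead.
  exact/recursive_succ/recursive_thead.
apply: recursive_ext (recursive_mul r1 (recp_leq (recursive_const k 1) rg)) _ => x.
rewrite asboolb; case: posnP => [->|g0]; first by rewrite muln0 divn0.
rewrite muln1 -(big_mkord xpredT (fun i => nat_of_bool `[< i.+1 * g x <= f x >])).
rewrite (big_cat_nat _ (n := f x %/ g x)) //=; last exact: leq_div.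
rewrite [X in _ + X]big_nat_cond [X in _ + X]big1 ?addn0; last first.
  move=> i; rewrite andbT => /andP[fgi _]; rewrite asboolb.
  by rewrite leqNgt -ltn_divLR // ltnS fgi.
rewrite big_nat_cond (eq_bigr (fun=> 1)) -?big_nat_cond.
  by rewrite sum_nat_const_nat subn0 muln1.
by move=> i; rewrite andbT asboolb -leq_divRL // => /andP[_ ->].
Qed.

Lemma recursive_mod (k : nat) (f g : k.-tuple nat -> nat) :
  recursive f -> recursive g -> recursive (fun x => f x %% g x).
Proof.
move=> rf rg; apply: recursive_ext
  (recursive_sub rf (recursive_mul (recursive_div rf rg) rg)) _ => x.
by rewrite {1}(divn_eq (f x) (g x)) addKn.
Qed.

(** * Positional codes *)

Lemma sum_digits_lt (b L : nat) (d : nat -> nat) :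
  (forall i, i < L -> d i < b) -> \sum_(i < L) d i * b ^ i < b ^ L.
Proof.
elim: L => [|L IH] db; first by rewrite big_ord0.
rewrite big_ord_recr /= expnS.
apply: (@leq_trans (b ^ L + d L * b ^ L)).
  by rewrite ltn_add2r; apply: IH => i iL; apply: db; rewrite ltnS ltnW.
by rewrite -mulSn leq_mul2r db ?orbT.
Qed.

Lemma digit_sum (b L : nat) (d : nat -> nat) (j : nat) :
  (forall i, i < L -> d i < b) -> j < L ->
  (\sum_(i < L) d i * b ^ i) %/ b ^ j %% b = d j.
Proof.
elim: L d j => // L IH d j db jL; rewrite big_ord_recl expn0 muln1.
have b0 : 0 < b by apply: leq_ltn_trans (db 0 _).
have -> : \sum_(i < L) d (bump 0 i) * b ^ bump 0 i =
          (\sum_(i < L) d i.+1 * b ^ i) * b.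
  by rewrite big_distrl; apply: eq_bigr => i _; rewrite expnSr mulnA.
case: j jL => [|j] jL.
  by rewrite expn0 divn1 addnC modnMDl modn_small // db.
rewrite expnS divnMA addnC divnMDl // (@divn_small (d 0)) ?db// addn0.
by rewrite (IH (fun i => d i.+1)) // => i iL; apply: db.
Qed.

Lemma tuple_code_lt (n a : nat) (t : a.-tuple 'I_n) : tuple_code t < n ^ a.
Proof.
rewrite /tuple_code; case: a t => [|a] t; first by rewrite big_ord0.
(* [inord] extends the digits to a function on all naturals; it needs a nonzero length, hence the
   case split. *)
rewrite (eq_bigr (fun j : 'I__ => tnth t (inord j) * n ^ j)) => [|i _].
  exact: (@sum_digits_lt n a.+1 (fun j => tnth t (inord j))).
by rewrite inord_val.
Qed.

Lemma tuple_code_digit (n a : nat) (t : a.-tuple 'I_n) (j : 'I_a) :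
  tuple_code t %/ n ^ j %% n = tnth t j.
Proof.
rewrite /tuple_code; case: a t j => [|a] t j; first by case: j.
rewrite (eq_bigr (fun j : 'I__ => tnth t (inord j) * n ^ j)) => [|i _].
  by rewrite (@digit_sum n a.+1 (fun j => tnth t (inord j))) ?inord_val.
by rewrite inord_val.
Qed.

Lemma tuple_code_inj (n a : nat) : injective (@tuple_code n a).
Proof.
move=> t u tu; apply: eq_from_tnth => j; apply: val_inj => /=.
by rewrite -!tuple_code_digit tu.
Qed.

(** [tuple_code] is a bijection onto the numbers below [n ^ a]. The lemma serves both to read
    relations off their codes and to compute the code of the target. *)
Lemma sum_tuple_code (n a : nat) (A : {set a.-tuple 'I_n}) (Q : nat -> bool) :
  (forall t, Q (tuple_code t) = (t \in A)) ->
  \sum_(t in A) 2 ^ tuple_code t = \sum_(k < n ^ a) Q k * 2 ^ k.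
Proof.
move=> QA; pose f (t : a.-tuple 'I_n) := Ordinal (tuple_code_lt t).
have f_bij : bijective f.
  apply: inj_card_bij; first by move=> t u [/tuple_code_inj].
  by rewrite card_tuple !card_ord.
rewrite (reindex f) /=; last exact: onW_bij.
rewrite big_mkcond; apply: eq_bigr => t _.
by rewrite QA; case: (t \in A); rewrite ?mul1n ?mul0n.
Qed.

Definition bit (w k : nat) : Prop := w %/ 2 ^ k %% 2 = 1.

Lemma bit_fs_rel_code (Sig : signature) (X : fstructure Sig) (R : sym Sig)
    (t : (sar R).-tuple 'I_(fs_size X)) :
  bit (fs_rel_code X R) (tuple_code t) <-> t \in fs_rel X R.
Proof.
pose Q k := `[< exists2 u, u \in fs_rel X R & tuple_code u = k >].
have QE u : Q (tuple_code u) = (u \in fs_rel X R).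
  by apply/asboolP/idP => [[v + /tuple_code_inj <-//]|]; exists u.
rewrite /bit /fs_rel_code (sum_tuple_code QE).
rewrite (@digit_sum 2 _ (fun k => Q k)) ?tuple_code_lt//; last first.
  by move=> i _; case: (Q i).
by rewrite QE; case: (t \in _).
Qed.

Lemma recp_bit (k : nat) (f g : k.-tuple nat -> nat) :
  recursive f -> recursive g -> recursive_predicate (fun x => bit (f x) (g x)).
Proof.
move=> rf rg; apply: recp_eq (recursive_const k 1).
apply: recursive_mod (recursive_const k 2).
exact: recursive_div (recursive_exp (recursive_const k 2) rg).
Qed.

Lemma lex_map_surj (h r : nat) (p : 'I_h -> 'I_r) :
  exists j : 'I_(r ^ h), lex_map j = p.
Proof.
case: h p => [|h] p.
  have j : 'I_(r ^ 0) by exact: ord0.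
  by exists j; apply/funext; case.
(* [lex_map] has its most significant digit at 0, while [digit_sum] counts from the least
   significant one; hence [rev_ord]. *)
pose d (i : nat) : nat := p (rev_ord (inord i)).
have dr i : i < h.+1 -> d i < r by move=> _; apply: ltn_ord.
exists (Ordinal (sum_digits_lt dr)); apply/funext => i; apply: val_inj => /=.
rewrite (digit_sum dr) ?ltn_subrL//=.
rewrite /d; congr (nat_of_ord (p _)); apply: val_inj => /=.
have ih : i <= h by rewrite -ltnS.
by rewrite inordK !subSS ?subKn // ltnS leq_subr.
Qed.

(** * Compactness *)

(** Otherwise the complement of every fibre is in the ultrafilter, but these finitely many
    complements have empty intersection. *)
Lemma ultrafilter_fin_choice (J : Type) (T : finType) (F : set_system J)
    (f : J -> T) : UltraFilter F -> exists t, F [set j | f j = t].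
Proof.
move=> FU; apply: contrapT => /forallNP nF.
have nFC t : F [set j | f j <> t].
  by have [/nF|] := in_ultra_setVsetC [set j | f j = t] FU.
have FC (s : seq T) : F [set j | f j \notin s].
  elim: s => [|t s IH]; first by apply: filterS filterT.
  apply: filterS (filterI (nFC t) IH) => j [/= /eqP ft fs].
  by rewrite inE negb_or ft.
have [j] := filter_ex (FC (enum T)).
by rewrite /= mem_enum.
Qed.

(** Homomorphisms on finite substructures of [S], indexed by finite lists of points, are glued by
    taking pointwise limits along an ultrafilter that contains, for each list, the set of lists
    including it. *)
Lemma compactness (Sig : signature) (S : structure Sig) (T : fstructure Sig) :
  (forall X : structure Sig, finite_set [set: X] -> maps_to X S -> maps_to X T) ->
  maps_to S T.
Proof.
move=> XST.
have [[x0]|nS] := pselect (inhabited S); last first.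
  apply: XST; last first.
    exists id => R t; congr (rel_of S R _).
    by apply: val_inj; rewrite /= map_id.
  by rewrite (_ : [set: S] = set0) //; apply/seteqP; split=> // x; case: nS.
(* A point without relations maps to [S], hence to [T]. This gives the default [t0], the value of
   [H] at points outside the list. *)
have [n0] : maps_to (@Structure Sig unit (fun _ => set0)) T.
  by apply: XST; [exact: (@finite_finset unit)|exists (fun=> x0)].
move=> _; have t0 := n0 tt.
pose X (s : seq {classic S}) : structure Sig :=
  @Structure Sig 'I_(size s)
    (fun R t => rel_of S R (map_tuple (fun i : 'I__ => nth x0 s i) t)).
have [g gP] : exists g : forall s, X s -> T, forall s, is_hom (g s).
  have Xs s : maps_to (X s) T.
    apply: XST; first exact: (@finite_finset 'I_(size s)).
    by exists (fun i : 'I__ => nth x0 s i).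
  by exists (fun s => sval (cid (Xs s))) => s; apply: svalP (cid (Xs s)).
pose H (x : S) (s : seq {classic S}) : 'I_(fs_size T) :=
  if insub (index (x : {classic S}) s) is Some i then g s i else t0.
have HP (R : sym Sig) (t : (sar R).-tuple S) (s : seq {classic S}) :
    rel_of S R t -> {subset (tval t : seq {classic S}) <= s} ->
    rel_of T R (map_tuple (H^~ s) t).
  move=> St ts.
  have [u uE] : exists u : (sar R).-tuple (X s),
      map_tuple (fun i : 'I__ => nth x0 s i) u = t /\
      map_tuple (g s) u = map_tuple (H^~ s) t.
    have i0 (i : 'I_(sar R)) : index (tnth t i : {classic S}) s < size s.
      by rewrite index_mem; apply: ts; apply: mem_tnth.
    exists [tuple Ordinal (i0 i) | i < sar R]; split; apply: eq_from_tnth => i.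
      rewrite !tnth_map tnth_ord_tuple /=.
      by apply: (@nth_index {classic S}); apply: ts; apply: mem_tnth.
    by rewrite !tnth_map tnth_ord_tuple /H (insubT (fun m => m < size s) (i0 i)).
  by case: uE => uS <-; apply: gP; rewrite /= uS.
pose F0 := filter_from setT (fun s : seq {classic S} =>
  [set s' : seq {classic S} | {subset s <= s'}]).
have F0F : ProperFilter F0.
  apply: filter_from_proper; last by move=> s _; exists s => x.
  apply: filter_from_filter; first by exists [::].
  move=> s s' _ _; exists (s ++ s') => // s'' ss; split=> x xs; apply: ss.
    by rewrite mem_cat xs.
  by rewrite mem_cat xs orbT.
have [F [FU F0F']] := ultraFilterLemma F0F.
have /choice[k kP] : forall x, exists t, F [set s | H x s = t].
  by move=> x; apply: ultrafilter_fin_choice.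
exists k => R t St.
(* Finitely many points reach their limits on a common list, which may also be taken to contain
   them; there the limit agrees with a homomorphism. *)
have FA (u : seq S) : F [set s | map (H^~ s) u = map k u].
  elim: u => [|x u IH]; first by apply: filterS filterT.
  by apply: filterS (filterI (kP x) IH) => s [/= -> ->].
have Ft : F [set s | {subset (tval t : seq {classic S}) <= s}].
  by apply: F0F'; exists (tval t).
have [s [/= st ts]] := filter_ex (filterI (FA t) Ft).
rewrite (_ : map_tuple k t = map_tuple (H^~ s) t); first exact: HP.
by apply: val_inj; rewrite /= st.
Qed.

Lemma maps_to_trans (Sig : signature) (X Y Z : structure Sig) :
  maps_to X Y -> maps_to Y Z -> maps_to X Z.
Proof.
move=> [f fh] [g gh]; exists (g \o f) => R t Xt.
rewrite (_ : map_tuple _ _ = map_tuple g (map_tuple f t)); first exact/gh/fh.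
by apply: val_inj; rewrite /= map_comp.
Qed.

Lemma finitely_equivalent_maps_to (Sig : signature) (S G : structure Sig)
    (T : fstructure Sig) :
  finitely_equivalent S G -> maps_to S T <-> maps_to G T.
Proof.
move=> SG; split=> [ST|GT]; apply: compactness => X finX.
  by move=> /(SG _ finX) XS; apply: maps_to_trans ST.
by move=> /(SG _ finX) XG; apply: maps_to_trans GT.
Qed.

Definition lex_index (h r : nat) (p : 'I_h -> 'I_r) : 'I_(r ^ h) :=
  sval (cid (lex_map_surj p)).

Lemma lex_indexK (h r : nat) (p : 'I_h -> 'I_r) : lex_map (lex_index p) = p.
Proof. exact: svalP (cid (lex_map_surj p)). Qed.

(** * The free structure over K *)

(* The homomorphisms to [B] from the free structure of [M] over [K], whose universe
   is [M r] and whose relation is {(f^(pi_1), ..., f^(pi_m)) : f of arity h}. *)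
Definition free_hom (M : minion) (h r : nat) (B : fstructure (Ksig h.+1 r.+1))
    (phi : M r -> 'I_(fs_size B)) : Prop :=
  forall f : M h,
    [tuple phi (minor (lex_map j) f) | j < r.+1 ^ h.+1] \in fs_rel B tt.

(** This is the universal property of the free structure: [phi] evaluates the polymorphism of an
    r-ary element at the identity, and conversely [f] goes to the polymorphism sending [b] to [phi]
    of the minor of [f] along [b]. *)
Lemma maps_to_PolP (M : minion) (h r : nat) (B : fstructure (Ksig h.+1 r.+1)) :
  minion_maps_to M (Pol (K h.+1 r.+1) B) <->
  exists phi : M r -> 'I_(fs_size B), free_hom phi.
Proof.
split=> [[F FE]|[phi phiE]].
  exists (fun f => sval (F r f) id) => f.
  have := svalP (F h f) tt
    [tuple (lex_map j : 'I_h.+1 -> 'I_r.+1) | j < r.+1 ^ h.+1].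
  rewrite /= => /(_ _)/=.
  rewrite (_ : map_tuple _ _ =
      [tuple sval (F r (minor (lex_map j) f)) id | j < r.+1 ^ h.+1]).
    apply=> i; rewrite (_ : map_tuple _ _ = [tuple lex_map j i | j < r.+1 ^ h.+1]).
      exact: imset_f.
    by apply: eq_from_tnth => j; rewrite !tnth_map !tnth_ord_tuple.
  by apply: eq_from_tnth => j; rewrite !tnth_map !tnth_ord_tuple FE.
have pol n (f : M n) :
    is_hom (fun b : power (K h.+1 r.+1) n.+1 => phi (minor b f) : B).
  move=> [] t /= Kt.
  (* Each coordinate of [t] is a row of the relation of [K]. If [k] selects these rows, the entries
     of [t] are the maps [lex_map j \o k], so [phiE] applies to [minor k f]. *)
  have /choice[k kE] : forall i, exists k : 'I_h.+1,
      forall j, tnth t j i = lex_map j k.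
    move=> i; have /imsetP[k _ tE] := Kt i; exists k => j.
    by have := congr1 (fun u => tnth u j) tE; rewrite !tnth_map tnth_ord_tuple.
  rewrite (_ : map_tuple _ _ =
      [tuple phi (minor (lex_map j) (minor k f)) | j < r.+1 ^ h.+1]).
    exact: phiE.
  apply: eq_from_tnth => j; rewrite !tnth_map tnth_ord_tuple -minor_comp.
  congr (phi (minor _ f)).
  by apply/funext => i; rewrite /= kE.
exists (fun n f => exist _ _ (pol n f)) => n m p f; apply: eq_exist.
by apply/funext => b; rewrite /= -minor_comp.
Qed.

(** A point of [K] is sent to [phi] of the minor of the unary [e] along the constant map; a row of
    the relation then comes from the minors of a single h-ary element. *)
Lemma free_hom_maps_to_K (M : minion) (h r : nat)
    (B : fstructure (Ksig h.+1 r.+1)) (phi : M r -> 'I_(fs_size B)) (e : M 0) :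
  free_hom phi -> maps_to (K h.+1 r.+1) B.
Proof.
move=> phiE; exists (fun x => phi (minor (fun=> x) e)) => -[] t /imsetP[i _ ->].
rewrite /= (_ : map_tuple _ _ =
    [tuple phi (minor (lex_map j) (minor (fun=> i) e)) | j < r.+1 ^ h.+1]).
  exact: phiE.
by apply: eq_from_tnth => j; rewrite !tnth_map !tnth_ord_tuple -minor_comp.
Qed.

(** * Quotient minions *)

Section Quotient.
Variables (M : minion) (D : set (property M)).

Lemma eq_quo_class (n : nat) (f g : M n) :
  quo_class D f = quo_class D g <-> deq D f g.
Proof.
split=> [/(congr1 sval)/= E|fg].
  have : [set k | deq D g k] g by apply: deq_refl.
  by rewrite -E.
apply: eq_exist; apply/seteqP; split=> k /=; apply: deq_trans => //.
exact: deq_sym.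
Qed.

(** A stable property contains a class entirely or not at all, so membership can be read off any
    representative. *)
Lemma stable_quo_property (Q : property M) (f : M (par Q)) :
  stable D Q -> @quo_property M D Q (quo_class D f) <-> pset Q f.
Proof.
move=> [S QE]; split=> [[g Qg /eq_quo_class gf]|]; last by exists f.
move: Qg; rewrite QE => -[c Sc cg]; exists c => //.
move: cg; have [k ->] := quo_classP c => /= kg.
exact: deq_trans kg gf.
Qed.

(** A class is determined by the finite table of outcomes of all tests, one for each property in [D]
    and each map into its arity. *)
Lemma finite_quo (n : nat) : finite_set D -> finite_set [set: quo_elt D n].
Proof.
move=> /(@finite_seqP {classic property M})[s sE].
pose P (i : 'I_(size s)) : property M := tnth (in_tuple s) i.
have DP (Q : property M) : D Q -> exists i, Q = P i.
  by rewrite sE => /(@tnthP _ {classic property M} (in_tuple s)).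
pose repr (c : quo_elt D n) : M n := sval (cid (quo_classP c)).
have reprK c : c = quo_class D (repr c) by apply: svalP (cid (quo_classP c)).
pose J := {i : 'I_(size s) & {ffun 'I_n.+1 -> 'I_(ar (P i))}}.
pose sig c : {ffun J -> bool} :=
  [ffun x : J => `[< pset (P (tag x))
    (minor (tagged x : {ffun _ -> _}) (repr c)) >]].
have sig_inj : injective sig.
  move=> c c' /ffunP E; rewrite (reprK c) (reprK c'); apply/eq_quo_class.
  move=> Q /DP[i ->] p; pose x : J := Tagged _ (finfun p).
  have := E x; rewrite !ffunE /=.
  have -> : (finfun p : 'I_n.+1 -> 'I_(ar (P i))) = p.
    by apply/funext => k; rewrite ffunE.
  exact: asbool_eq_equiv.
rewrite -(preimage_setT sig); apply: finite_preimage finite_finset.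
by move=> c c' _ _; apply: sig_inj.
Qed.

(** A map into the arity of some [Q] in [D] factors through the r-element set, by an inclusion
    followed by a retraction; so the r-ary minors decide all tests. *)
Lemma quo_ext (n r : nat) (c c' : quotient_minion D n) :
  (forall Q, D Q -> ar Q <= r.+1) ->
  (forall p : 'I_n.+1 -> 'I_r.+1, minor p c = minor p c') -> c = c'.
Proof.
move=> arD; have [f ->] := quo_classP c; have [g ->] := quo_classP c' => E.
apply/eq_quo_class => Q DQ p.
have := E (fun i => inord (p i)); rewrite /= !quo_minor_class.
move=> /eq_quo_class/(_ Q DQ (fun i => inord i)); rewrite -!minor_comp.
rewrite (_ : _ \o _ = p) //; apply/funext => i; apply: val_inj => /=.
by rewrite !inordK // (leq_trans (ltn_ord (p i)) (arD _ DQ)).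
Qed.

End Quotient.

(* A retraction [b] -> [a] or an inclusion [a] -> [b], depending on the order. *)
Definition recast (a b : nat) (i : 'I_a.+1) : 'I_b.+1 := inord i.
Arguments recast : clear implicits.

Lemma recastK (a b : nat) : a <= b -> recast b a \o recast a b = id.
Proof.
move=> ab; apply/funext => i; apply: val_inj; rewrite /= /recast.
by rewrite !inordK // (leq_trans (ltn_ord i)).
Qed.

Lemma minor_recastK (M : minion) (a b : nat) (f : M a) :
  a <= b -> minor (recast b a) (minor (recast a b) f) = f.
Proof. by move=> ab; rewrite -minor_comp recastK // minor_id. Qed.

(** * The target of the reduction *)

Lemma finite_fun_ord (a b : nat) : finite_set [set: 'I_a -> 'I_b].
Proof.
rewrite (_ : setT = range (fun f : {ffun 'I_a -> 'I_b} => f : 'I_a -> 'I_b)).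
  exact/finite_image/finite_finset.
apply/seteqP; split=> // f _; exists (finfun f) => //.
by apply/funext => i; rewrite ffunE.
Qed.

Section Target.
Variables (Sig : signature) (M : minion) (D : set (property M)).
Variables (I : interpretation Sig M) (h r : nat).
Hypothesis le_rh : r <= h.
Hypothesis intI : internal_interpretation D h.+1 I.
Hypothesis arD : forall Q : property M, D Q -> ar Q <= r.+1.
Hypothesis arU : par (int_univ I) <= r.
Variables (q : nat) (dec : nat -> quotient_minion D r).
Hypothesis dec_surj : forall c, exists2 i, i < q & dec i = c.

Let N := quotient_minion D.
Let U := int_univ I.
Let UQ := @quo_property M D U.
Let RQ R := @quo_property M D (int_rel I R).
Let lift_index (p : 'I_h.+1 -> 'I_(ar U)) : 'I_(r.+1 ^ h.+1) :=
  lex_index (recast (par U) r \o p).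

(* The number [d j] stands for the pair ([dec (d j %% q)], [d j %/ q]); values
   [d j %/ q = n] are the dummies.  The value at a minor c^p in U is read off at the
   index of any map [h] -> [r] lifting p. *)
Definition target_rel (n : nat) (w : sym Sig -> nat)
    (d : 'I_(r.+1 ^ h.+1) -> nat) : Prop :=
  exists c : N h,
    [/\ forall j, dec (d j %% q) = minor (lex_map j) c,
        forall p : 'I_h.+1 -> 'I_(ar U), UQ (minor p c) ->
          d (lift_index p) %/ q < n &
        forall (R : sym Sig) (p : 'I_h.+1 -> 'I_(ar (int_rel I R))),
          RQ (minor p c) ->
          (forall i : 'I_(sar R), UQ (minor (int_map i \o p) c)) ->
          bit (w R) (\sum_(i < sar R)
            d (lift_index (int_map i \o p)) %/ q * n ^ i)].

(** The size counts [q] class numbers times the elements of [T] and one dummy. *)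
Definition target (T : fstructure Sig) : fstructure (Ksig h.+1 r.+1) :=
  @FStructure (Ksig h.+1 r.+1) (q * (fs_size T).+1)
    (fun=> [set t : (r.+1 ^ h.+1).-tuple 'I_(q * (fs_size T).+1) |
            `[< target_rel (fs_size T) (fs_rel_code T)
                          (fun j => tnth t j) >] ]%SET).

(** An r-ary [f] goes to its class paired with the image under [s] of its minor in [U], or with the
    dummy if that minor is not in [U]. For h-ary [f] the class of [f] witnesses the relation. *)
Lemma target_free_hom (T : fstructure Sig) :
  maps_to (global_structure I) T ->
  exists phi : M r -> 'I_(fs_size (target T)), free_hom phi.
Proof.
move=> [s sP]; set n := fs_size T.
have /choice[cd cdP] : forall f : M r, exists i, i < q /\ dec i = quo_class D f.
  by move=> f; have [i iq iE] := dec_surj (quo_class D f); exists i.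
pose v (g : M (par U)) : nat :=
  if pselect (pset U g) is left Ug then s (exist _ g Ug) else n.
have vn g : v g <= n by rewrite /v; case: pselect => // Ug; apply: ltnW.
pose d (f : M r) := cd f + q * v (minor (recast r (par U)) f).
have d_lt f : d f < q * n.+1.
  have [cq _] := cdP f; rewrite /d mulnS.
  by apply: (leq_trans (n := q + q * v (minor (recast r (par U)) f)));
    rewrite ?ltn_add2r // leq_add2l leq_mul2l vn orbT.
have d_mod f : d f %% q = cd f.
  by have [cq _] := cdP f; rewrite /d addnC mulnC modnMDl modn_small.
have d_div f : d f %/ q = v (minor (recast r (par U)) f).
  have [cq _] := cdP f; rewrite /d addnC mulnC divnMDl; last exact: leq_ltn_trans cq.
  by rewrite divn_small // addn0.
exists (fun f => Ordinal (d_lt f)) => f; rewrite inE; apply/asboolP.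
have [stU _] := intI.1; have stR R := (intI.2 R).1.
(* The retraction inside [d] undoes the lift, so the stored value depends on [p] only. *)
have lift_div (p : 'I_h.+1 -> 'I_(ar U)) :
    tnth [tuple Ordinal (d_lt (minor (lex_map j) f)) | j < r.+1 ^ h.+1]
      (lift_index p) %/ q = v (minor p f).
  rewrite tnth_map tnth_ord_tuple /= d_div lex_indexK -minor_comp.
  by rewrite compA recastK.
exists (quo_class D f); split.
- move=> j; rewrite tnth_map tnth_ord_tuple /= d_mod (cdP _).2.
  by rewrite quo_minor_class.
- move=> p; rewrite /= quo_minor_class => /(stable_quo_property _ stU) Up.
  by rewrite lift_div /v; case: pselect => // Up'; apply: ltn_ord.
move=> R p; rewrite /= quo_minor_class => /(stable_quo_property _ (stR R)) Rp Up.
have {}Up (i : 'I_(sar R)) : pset U (minor (int_map i \o p) f).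
  by have := Up i; rewrite quo_minor_class => /(stable_quo_property _ stU).
pose t : (sar R).-tuple (global_structure I) :=
  [tuple exist _ (minor (int_map i \o p) f) (Up i) | i < sar R].
have : rel_of T R (map_tuple s t).
  apply: sP; exists (minor p f) => // i.
  by rewrite tnth_map tnth_ord_tuple -minor_comp.
move=> /bit_fs_rel_code bitR.
rewrite [X in bit _ X](_ : _ = tuple_code (map_tuple s t)) //.
apply: eq_bigr => i _; rewrite lift_div tnth_map tnth_map tnth_ord_tuple /v.
by case: pselect => // Up'; rewrite (Prop_irrelevance (Up i) Up').
Qed.

Lemma maps_to_of_target_free_hom (T : fstructure Sig)
    (phi : M r -> 'I_(fs_size (target T))) :
  free_hom phi -> maps_to (global_structure I) T.
Proof.
move=> phiP; set n := fs_size T; set u := par U.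
have uh : u <= h by apply: leq_trans le_rh.
have /choice[H HP] : forall f : M h, exists c : N h,
    [/\ forall p, dec (phi (minor p f) %% q) = minor p c,
        forall p : 'I_h.+1 -> 'I_(ar U), UQ (minor p c) ->
          phi (minor (recast u r \o p) f) %/ q < n &
        forall (R : sym Sig) (p : 'I_h.+1 -> 'I_(ar (int_rel I R))),
          RQ (minor p c) ->
          (forall i : 'I_(sar R), UQ (minor (int_map i \o p) c)) ->
          bit (fs_rel_code T R) (\sum_(i < sar R)
            phi (minor (recast u r \o (int_map i \o p)) f) %/ q * n ^ i)].
  move=> f; have := phiP f; rewrite inE => /asboolP[c [c1 c2 c3]]; exists c; split.
  - move=> p; have := c1 (lex_index p).
    by rewrite tnth_map tnth_ord_tuple lex_indexK.
  - by move=> p /c2; rewrite tnth_map tnth_ord_tuple lex_indexK.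
  move=> R p Rp Up; have := c3 R p Rp Up.
  rewrite (eq_bigr (fun i : 'I_(sar R) =>
    phi (minor (recast u r \o (int_map i \o p)) f) %/ q * n ^ i)) // => i _.
  by rewrite tnth_map tnth_ord_tuple lex_indexK.
(* Both sides have the same r-ary minors, decoded from the values of [phi] at minors of [f]. *)
have H_minor (a : 'I_h.+1 -> 'I_h.+1) f : H (minor a f) = minor a (H f).
  apply: (quo_ext (r := r)) => // p; rewrite -minor_comp.
  have [<- _ _] := HP f; have [<- _ _] := HP (minor a f).
  by rewrite minor_comp.
(* Lower arities are embedded into the top arity, mapped by [H], and retracted. *)
pose F m (_ : m.+1 <= h.+1) (f : M m) : N m :=
  minor (recast h m) (H (minor (recast m h) f)).
have F_minor m m' (lem : m.+1 <= h.+1) (lem' : m'.+1 <= h.+1)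
    (p : 'I_m.+1 -> 'I_m'.+1) (f : M m) :
    F m' lem' (minor p f) = minor p (F m lem f).
  rewrite /F.
  have -> : minor (recast m' h) (minor p f) =
      minor (recast m' h \o (p \o recast h m)) (minor (recast m h) f).
    by rewrite 2!minor_comp minor_recastK.
  by rewrite H_minor 2!minor_comp minor_recastK.
pose PF := PartialHom F_minor.
have UF (uh1 : u.+1 <= h.+1) f : pset U f -> UQ (F u uh1 f).
  move=> Uf; have [_ [leh /(_ PF)]] := intI.1; apply.
  by exists f => //; rewrite /= /F.
have RF R f (ah : (par (int_rel I R)).+1 <= h.+1) :
    pset (int_rel I R) f -> RQ (F _ ah f).
  move=> Rf; have [_ [leh /(_ PF)]] := intI.2 R; apply.
  by exists f.
(* The point is viewed in the top arity and retracted by [recast h u]; internality, through [UF],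
   excludes the dummy. *)
have v_lt (x : global_structure I) : phi (minor (recast u r) (sval x)) %/ q < n.
  case: x => f Uf /=; have [_ + _] := HP (minor (recast u h) f).
  move=> /(_ (recast h u) (UF uh _ Uf)).
  by rewrite minor_comp minor_recastK.
exists (fun x => Ordinal (v_lt x)) => R t [g Rg gE].
have ah : par (int_rel I R) <= h by have [_ []] := intI.2 R.
have [_ _ /(_ R (recast h _) (RF _ _ ah Rg))] := HP (minor (recast _ h) g).
move=> bitR; apply/bit_fs_rel_code; move: bitR.
rewrite /tuple_code => /(_ _); rewrite (eq_bigr (fun i : 'I_(sar R) =>
  tnth (map_tuple (fun x => Ordinal (v_lt x)) t) i * n ^ i)).
  (* Since [F] commutes with minors, the minors in question are the images under [F] of the entries
     of [t], which lie in [U]. *)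
  apply=> i; rewrite minor_comp -/(F _ ah g) -(F_minor _ _ ah uh) gE.
  by apply: UF; apply: svalP (tnth t i).
by move=> i _; rewrite tnth_map 2!minor_comp minor_recastK // gE.
Qed.

(** * Computability of the target *)

Hypothesis finD : finite_set D.

(** All quantifiers range over fixed finite sets and membership in [UQ] and [RQ] is independent of
    the input, so only arithmetic on [n], [w] and [d] remains. *)
Lemma recp_target_rel (k : nat) (n : k.-tuple nat -> nat)
    (w : sym Sig -> k.-tuple nat -> nat)
    (d : 'I_(r.+1 ^ h.+1) -> k.-tuple nat -> nat) :
  recursive n -> (forall R, recursive (w R)) -> (forall j, recursive (d j)) ->
  recursive_predicate (fun x => target_rel (n x) (w^~ x) (d^~ x)).
Proof.
move=> rn rw rd.
have q_gt0 : 0 < q by have [i iq _] := dec_surj (dec 0); apply: leq_ltn_trans iq.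
have rdq j : recursive (fun x => d j x %/ q).
  exact: recursive_div (recursive_const k q).
apply: (@recp_exists _ (N h)) (finite_quo h finD) _ => c.
pose P1 x := forall j, dec (d j x %% q) = minor (lex_map j) c.
pose P2 x := forall p : 'I_h.+1 -> 'I_(ar U), UQ (minor p c) ->
  d (lift_index p) x %/ q < n x.
pose P3 x := forall (R : sym Sig) (p : 'I_h.+1 -> 'I_(ar (int_rel I R))),
  RQ (minor p c) -> (forall i : 'I_(sar R), UQ (minor (int_map i \o p) c)) ->
  bit (w R x) (\sum_(i < sar R) d (lift_index (int_map i \o p)) x %/ q * n x ^ i).
suff r123 : recursive_predicate (fun x => P1 x /\ P2 x /\ P3 x).
  by apply: recp_ext r123 _ => x; split=> [[? []]|[]].
apply: recp_and; [|apply: recp_and].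
- apply: recp_forall => [|j]; first exact: finite_finset.
  (* [dec] is an arbitrary function, so its values are tested by a finite disjunction over the
     residues modulo [q]. *)
  have rj : recursive_predicate (fun x : k.-tuple nat =>
      exists v : 'I_q, d j x %% q = v /\ dec v = minor (lex_map j) c).
    apply: recp_exists => [|v]; first exact: finite_finset.
    apply: recp_and (recp_const _ _); apply: recp_eq (recursive_const _ _).
    exact: recursive_mod (recursive_const _ _).
  apply: recp_ext rj _ => x; split=> [[v [-> //]]|E].
  by exists (Ordinal (ltn_pmod (d j x) q_gt0)).
- apply: recp_forall => [|p]; first exact: finite_fun_ord.
  apply: recp_imp (recp_const _ _) _.
  exact: recp_leq (recursive_succ (rdq _)) rn.
apply: recp_forall => [|R]; first exact: finite_finset.
apply: recp_forall => [|p]; first exact: finite_fun_ord.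
do 2!apply: recp_imp (recp_const _ _) _.
apply: recp_bit => //; apply: recursive_sum_fin => i.
by apply: recursive_mul => //; apply: recursive_exp => //; apply: recursive_const.
Qed.

Lemma target_rel_code (T : fstructure Sig) (R : unit) :
  fs_rel_code (target T) R =
  \sum_(k < (q * (fs_size T).+1) ^ (r.+1 ^ h.+1))
    nat_of_bool `[< target_rel (fs_size T) (fs_rel_code T)
      (fun j => k %/ (q * (fs_size T).+1) ^ j %% (q * (fs_size T).+1)) >] * 2 ^ k.
Proof.
apply: (sum_tuple_code (Q := fun k => `[< target_rel (fs_size T) (fs_rel_code T)
  (fun j => k %/ (q * (fs_size T).+1) ^ j %% (q * (fs_size T).+1)) >])) => t.
rewrite inE; congr asbool; congr target_rel.
by apply/funext => j; rewrite tuple_code_digit.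
Qed.

(** A map into the target is coded by its values as base-b digits of one number, with b the target
    size; its existence thus becomes a bounded search. *)
Lemma maps_to_targetP (T : fstructure Sig) :
  (exists2 k, k < (q * (fs_size T).+1) ^ r.+1 &
    forall i : 'I_h.+1, target_rel (fs_size T) (fs_rel_code T)
      (fun j => k %/ (q * (fs_size T).+1) ^ lex_map j i %% (q * (fs_size T).+1))) <->
  maps_to (K h.+1 r.+1) (target T).
Proof.
set b := q * (fs_size T).+1; split=> [[k kb kP]|[e eP]].
  have b_gt0 : 0 < b by rewrite lt0n; apply: contraTneq kb => ->; rewrite exp0n.
  exists (fun x : 'I_r.+1 => Ordinal (ltn_pmod (k %/ b ^ x) b_gt0)).
  move=> R t /imsetP[i _ ->]; rewrite /= inE; apply/asboolP.
  rewrite [X in target_rel _ _ X](_ : _ = fun j => k %/ b ^ lex_map j i %% b) //.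
  by apply/funext => j; rewrite tnth_map tnth_map tnth_ord_tuple.
exists (tuple_code [tuple (e x : 'I_b) | x < r.+1]); first exact: tuple_code_lt.
move=> i; pose t := [tuple lex_map j i | j < r.+1 ^ h.+1].
have Kt : rel_of (K h.+1 r.+1) tt t by apply: imset_f.
have := eP tt t Kt; rewrite /= inE => /asboolP.
have -> // : (fun j => tuple_code [tuple (e x : 'I_b) | x < r.+1] %/
    b ^ lex_map j i %% b) = fun j => tnth (map_tuple e t) j.
by apply/funext => j; rewrite tuple_code_digit !tnth_map !tnth_ord_tuple.
Qed.

End Target.

Theorem theorem7p4 (Sig : signature) (G : structure Sig) (M : minion)
    (D : set (property M)) (I : interpretation Sig M) (h r : nat)
    (finD : finite_set D)
    (le_rh : r <= h)
    (undecG : undecidable_set (@fcode Sig) [set T : fstructure Sig | maps_to G T])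
    (intI : internal_interpretation D h I)
    (eqSG : finitely_equivalent (global_structure I) G)
    (arD : forall Q : property M, D Q -> ar Q <= r)
    (arU : ar (int_univ I) <= r) :
  undecidable_set (@tcode (Ksig h r))
    [set AB : template (Ksig h r) |
      tsrc AB = K h r /\ minion_maps_to M (Pol (K h r) (ttgt AB))].
Proof.
(* [r = 0] contradicts [arU], and then [h = 0] contradicts [le_rh]. From here on both names denote
   one less than the original numbers. *)
case: r => [|r] in le_rh arD arU *; first by [].
case: h => [|h] in le_rh intI *; first by [].
move=> [chi rchi chiP]; apply: undecG.
(* Without unary elements [M] is empty, so the global structure is empty and maps to every [T]; the
   constant 1 then decides the problem for [G]. *)
have [[e]|noM] := pselect (inhabited (M 0)); last first.
  exists (fun=> 1); first exact: recursive_const.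
  move=> T; rewrite asboolT //; apply/(finitely_equivalent_maps_to T eqSG).
  have noM' n (f : M n) : False by apply: noM; exists; apply: minor (fun=> ord0) f.
  exists (fun x => False_rect _ (noM' _ (sval x))) => R t [g _ _].
  by case: (noM' _ g).
have [s sE] := (@finite_seqP {classic quo_elt D r} setT).1 (finite_quo r finD).
pose dec i : quotient_minion D r := nth (quo_class D (minor (fun=> ord0) e)) s i.
pose q := size s.
have dec_surj c : exists2 i, i < q & dec i = c.
  have cs : (c : {classic quo_elt D r}) \in s.
    by have : [set: {classic quo_elt D r}] c by []; rewrite sE.
  exists (index (c : {classic quo_elt D r}) s); first by rewrite /q index_mem.
  by rewrite /dec; apply: (@nth_index {classic quo_elt D r}).
pose B (T : fstructure Sig) := @target Sig M D I h r q dec T.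
have GB (T : fstructure Sig) : maps_to G T <->
    exists phi : M r -> 'I_(fs_size (B T)), free_hom phi.
  apply: iff_trans (iff_sym (finitely_equivalent_maps_to T eqSG)) _; split.
    exact: target_free_hom.
  by move=> [phi]; apply: maps_to_of_target_free_hom.
pose m := r.+1 ^ h.+1; pose k := #|sym Sig|.+1.
pose n (x : k.-tuple nat) := thead x.
pose w R (x : k.-tuple nat) := tnth x (lift ord0 (enum_rank R)).
pose b x := q * (n x).+1.
(* [W] computes the relation code of [B T] from the code of [T], and [ok] is the search for a
   homomorphism from [K] to [B T]. *)
pose W (x : k.-tuple nat) := \sum_(c < b x ^ m) nat_of_bool `[< target_rel I q dec
  (n x) (w^~ x) (fun j : 'I_m => c %/ b x ^ j %% b x) >] * 2 ^ c.
pose ok (x : k.-tuple nat) := exists2 c, c < b x ^ r.+1 &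
  forall i : 'I_h.+1, target_rel I q dec
    (n x) (w^~ x) (fun j : 'I_m => c %/ b x ^ lex_map j i %% b x).
have rn : recursive n by apply: recursive_thead.
have rw R : recursive (w R) by apply: rec_proj.
have rb : recursive b.
  exact: recursive_mul (recursive_const _ _) (recursive_succ rn).
have r_digit a : recursive (fun y : k.+1.-tuple nat =>
    thead y %/ b (behead_tuple y) ^ a %% b (behead_tuple y)).
  have rb' := recursive_behead rb; apply: recursive_mod => //.
  apply: recursive_div; first exact: recursive_thead.
  exact: recursive_exp (recursive_const _ _).
have r_rel (a : 'I_m -> nat) : recursive_predicate (fun y : k.+1.-tuple nat =>
    target_rel I q dec (n (behead_tuple y)) (w^~ (behead_tuple y))
      (fun j : 'I_m => thead y %/ b (behead_tuple y) ^ a j %% b (behead_tuple y))).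
  apply: (@recp_target_rel _ _ _ I h r q dec dec_surj finD k.+1
    (fun y => n (behead_tuple y)) (fun R y => w R (behead_tuple y))
    (fun j y => thead y %/ b (behead_tuple y) ^ a j %% b (behead_tuple y))).
  - exact: recursive_behead.
  - by move=> R; apply: recursive_behead.
  - by move=> j; apply: r_digit.
have rW : recursive W.
  apply: (recursive_sum (F := fun c x => nat_of_bool `[< target_rel I q dec
    (n x) (w^~ x) (fun j : 'I_m => c %/ b x ^ j %% b x) >] * 2 ^ c)); last first.
    exact: recursive_exp (recursive_const _ _).
  apply: recursive_mul; first exact: r_rel (fun j => j).
  exact: recursive_exp (recursive_const _ _) (recursive_thead _).
have rok : recursive_predicate ok.
  apply: recp_exists_lt; last exact: recursive_exp (recursive_const _ _).
  apply: recp_forall => [|i]; first exact: finite_finset.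
  exact: r_rel (fun j => lex_map j i).
pose l := #|sym (Ksig h.+1 r.+1)|.
pose code x := [tuple of fcode (K h.+1 r.+1) ++
  [tuple of b x :: [tuple W x | i < l]]].
have rcode i : recursive (fun x => tnth (code x) i).
  case: (split_ordP i) => j ->.
    apply: recursive_ext (recursive_const _ (tnth (fcode (K h.+1 r.+1)) j)) _ => x.
    by rewrite tnth_lshift.
  case: (unliftP ord0 j) => [j'|] ->.
    by apply: recursive_ext rW _ => x; rewrite tnth_rshift tnthS tnth_mktuple.
  by apply: recursive_ext rb _ => x; rewrite tnth_rshift tnth0.
(* [chi] is specified only on codes of templates; the first factor discards its value when [K] does
   not map to [B T]. *)
exists (fun x => nat_of_bool `[< ok x >] * chi (code x)).
  apply: recursive_mul rok _; apply: recursive_ext (rec_comp rchi rcode) _ => x.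
  by congr chi; apply: eq_from_tnth => i; rewrite tnth_mktuple.
move=> T.
have nT : n (fcode T) = fs_size T by [].
have wT : w^~ (fcode T) = fs_rel_code T.
  by apply/funext => R; rewrite /w /fcode tnthS tnth_mktuple enum_rankK.
have WT R : W (fcode T) = fs_rel_code (B T) R.
  by rewrite /W /b nT wT target_rel_code.
have okT : ok (fcode T) <-> maps_to (K h.+1 r.+1) (B T).
  by rewrite /ok /b nT wT; apply: maps_to_targetP.
(* If the search fails, [G] does not map to [T]: a homomorphism would yield some [phi], and with [e]
   a homomorphism from [K] to [B T]. *)
have [/[dup] ok_T /okT KB|nok] := pselect (ok (fcode T)); last first.
  rewrite (asboolF nok) asboolF // => /GB[phi phiP].
  by apply: nok; apply/okT/(free_hom_maps_to_K e phiP).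
rewrite (asboolT ok_T) mul1n.
have -> : code (fcode T) = tcode (Template KB).
  congr [tuple of _ ++ _]; apply: eq_from_tnth => i.
  case: (unliftP ord0 i) => [i'|] ->; last by rewrite !tnth0.
  by rewrite !tnthS !tnth_mktuple.
rewrite chiP; apply: asbool_nat_eq; split=> [[_ /maps_to_PolP]|]; first by move/GB.
by move=> /GB/maps_to_PolP.
Qed.
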